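(* For every Tychonoff space $X$ with $|X|>1$ and every cardinal $\kappa$ there is a cardinal $\kappa'\geq\kappa$ such that the power $X^{\kappa'}$ is not D-separable.
   Context: Tychonoff spaces are $T_1$ and completely regular; powers carry the Tychonoff product topology. A subset is discrete if it is discrete in its subspace topology. A space $Y$ is D-separable if for every sequence $(D_n:n\in\omega)$ of dense subspaces of $Y$ one can pick discrete sets $F_n\subset D_n$ so that $\bigcup_{n\in\omega}F_n$ is dense in $Y$. *)

(* Defs.v *)
From HB Require Import structures.
From mathcomp Require Import all_boot all_order all_algebra.
From mathcomp Require Import all_classical all_reals topology normedtype.

Set Implicit Arguments.
Unset Strict Implicit.
Unset Printing Implicit Defensive.

Import Order.TTheory GRing.Theory Num.Theory.
Import numFieldNormedType.Exports.

Local Open Scope classical_set_scope.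
Local Open Scope ring_scope.

Definition tychonoff_space (X : topologicalType) : Prop :=
  accessible_space X /\ completely_regular_space X.

(* [completely_regular_space] is defined in the library through uniformities;
   this is the usual form with continuous functions into the unit interval. *)
Lemma completely_regular_spaceP (R : realType) (X : topologicalType) :
  completely_regular_space X <->
  forall (a : X) (B : set X), closed B -> ~ B a ->
    exists f : X -> R, [/\ continuous f, range f `<=` `[0, 1],
      f a = 0 & forall b, B b -> f b = 1].
Proof.
split=> crX a B clB Ba; have := crX a B clB Ba.
- move/(uniform_separatorP (R := R)) => [f [cf f01 fa fB]].
  exists f; split => //; first by apply: fa; exists a.
  by move=> b Bb; apply: fB; exists b.
- move=> [f [cf f01 fa fB]]; apply/(uniform_separatorP (R := R)).
  by exists f; split => // _ [b + <-] => [->|/fB].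
Qed.

(* [set_type A] carries the topology induced by the inclusion into [Y]. *)
Definition discrete_subset (Y : topologicalType) (A : set Y) : Prop :=
  forall U : set (set_type A), open U.

Definition D_separable (Y : topologicalType) : Prop :=
  forall D : nat -> set Y, (forall n, dense (D n)) ->
    exists F : nat -> set Y,
      [/\ forall n, F n `<=` D n,
          forall n, discrete_subset (F n) &
          dense (\bigcup_n F n)].

(* Main.v *)
Require Import Defs.
From HB Require Import structures.
From mathcomp Require Import all_boot all_order all_algebra.
From mathcomp Require Import all_classical all_reals topology normedtype.
From mathcomp Require Import wochoice.

(**
  Let [O] be a well-order of type [c^+], with [c] the continuum, and let [P] be
  the space of countable subsets of [O], a neighbourhood of [x] being given by
  the trace of [x] on an initial segment.  In [P] discrete sets are nowhere
  dense, and countable unions of nowhere dense sets are nowhere dense.  The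
  space [P] also has a remote filter in the sense of van Douwen: each nowhere
  dense [A] is disjoint from a clopen set [W A] that belongs to the filter.

  Take a disjoint sum of copies of [P] indexed by a type [S], and use as
  coordinates all the subsets [e] of [S * P].  On its copy of [P], the index
  [s] provides a function [v] of the trace of [e] on countably many points of
  [S * P]; the point [(s, x)] yields the element of the power whose coordinate
  [e] is the value of [v] if [x] is in [W] of the slice of [e] at [s], and a
  fixed [a] otherwise.  As finitely many coordinates are told apart by finitely
  many points and the [W] sets are centered, these elements are dense.  They
  depend continuously on [x], so a countable union of discrete sets of such
  elements comes from a set [e] with nowhere dense slices, and all its elements
  take the value [a] at the coordinate [e]: it is not dense.
*)

Set Implicit Arguments.
Unset Strict Implicit.
Unset Printing Implicit Defensive.

Import Order.TTheory.

Local Open Scope order_scope.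
Local Open Scope classical_set_scope.
Local Open Scope card_scope.

Section NowhereDense.
Context {T : topologicalType}.
Implicit Types A B U V : set T.

Definition nowhere_dense A := (closure A)^° = set0.

Lemma nowhere_denseP A : nowhere_dense A <->
  forall U, open U -> U !=set0 ->
    exists V, [/\ open V, V !=set0, V `<=` U & V `&` A = set0].
Proof.
split=> [ndA U oU U0|avoidA]; last first.
  apply: contrapT => /eqP/set0P cA0.
  have [V [oV [x Vx] VcA VA]] := avoidA _ (@open_interior _ _) cA0.
  have [|y [Ay Vy]] := interior_subset (VcA x Vx) V.
    exact: open_nbhs_nbhs.
  by have : (V `&` A) y by []; rewrite VA.
exists (U `\` closure A); split.
- by apply: openI => //; exact/closed_openC/closed_closure.
- apply: contrapT => /nonemptyPn UcA; have [x Ux] := U0.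
  have : U `<=` (closure A)^° by rewrite -open_subsetE// -setD_eq0.
  by rewrite ndA => /(_ x Ux).
- by move=> x [].
- by apply/disjoints_subset => x [_ nAx] /subset_closure.
Qed.

Lemma discrete_subsetP A : discrete_subset A <-> A `<=` isolated A.
Proof.
split=> [dA a Aa|isoA U].
  pose a' : A := SigSub (mem_set Aa).
  have [V oV VE] := dA [set a'].
  have Va : V a by have : (set_val @^-1` V) a' by rewrite VE.
  split; first exact: mem_set.
  exists V; first exact: open_nbhs_nbhs.
  apply/seteqP; split=> [x [Vx Ax]|_ ->] //.
  have : (set_val @^-1` V) (SigSub (mem_set Ax)) by [].
  by rewrite VE => /(congr1 set_val).
rewrite openE => u Uu; have [_ [V nV VA]] := isoA _ (set_valP u).
have : nbhs u (set_val @^-1` V) by exact: initial_continuous.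
apply: filterS => v Vv; suff -> : v = u by [].
have : [set set_val u] (set_val v) by rewrite -VA; split=> //; exact: set_valP.
exact: val_inj.
Qed.

Lemma discrete_nowhere_dense A :
  accessible_space T -> perfect_set [set: T] -> discrete_subset A ->
  nowhere_dense A.
Proof.
move=> T1 /perfectTP perfT /discrete_subsetP isoA.
apply/nowhere_denseP => U oU [x Ux].
have [[a [Ua Aa]]|UA] := pselect (U `&` A !=set0); last first.
  by exists U; split=> //; [exists x|exact/nonemptyPn].
have [_ [V]] := isoA a Aa.
rewrite nbhsE => -[V' [oV' V'a] V'V] VA.
have ca : closed [set a] by exact: accessible_closed_set1.
exists (U `&` V' `\` [set a]); split.
- by apply: openI; [exact: openI|exact: closed_openC].
- apply: contrapT => /nonemptyPn UV'a; apply: (perfT a).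
  suff <- : U `&` V' = [set a] by exact: openI.
  by apply/seteqP; split=> [|_ ->] //; rewrite -setD_eq0.
- by move=> y [[]].
- apply/disjoints_subset => y [[_ V'y] nay] Ay; apply: nay.
  by rewrite -VA; split=> //; exact: V'V.
Qed.

Definition nowhere_dense_sigma_closed := forall A : nat -> set T,
  (forall n, nowhere_dense (A n)) -> nowhere_dense (\bigcup_n A n).

Definition has_remote_filter :=
  exists2 F : set_system T, ProperFilter F &
    forall A, nowhere_dense A ->
      exists W, [/\ clopen W, F W & W `&` A = set0].

Lemma remote_filter_selection : has_remote_filter ->
  exists2 F : set_system T, ProperFilter F &
    exists W : set T -> set T, [/\ forall A, clopen (W A), forall A, F (W A) &
      forall A, nowhere_dense A -> W A `&` A = set0].
Proof.
move=> [F FF remote]; exists F => //.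
have /choice [W WP] : forall A, exists W,
    [/\ clopen W, F W & nowhere_dense A -> W `&` A = set0].
  move=> A; have [/remote [W [cW FW WA]]|] := pselect (nowhere_dense A).
    by exists W.
  by exists setT; split=> //; [exact: clopenT|exact: filterT].
by exists W; split=> A; have [] := WP A.
Qed.

End NowhereDense.
Arguments nowhere_dense_sigma_closed : clear implicits.
Arguments has_remote_filter : clear implicits.

Lemma discrete_subset_preimage (T U : topologicalType) (f : T -> U)
    (A : set T) (B : set U) :
  continuous f -> {in A &, injective f} -> f @` A `<=` B ->
  discrete_subset B -> discrete_subset A.
Proof.
move=> cf f_inj fAB /discrete_subsetP isoB; apply/discrete_subsetP => a Aa.
have [_ [V nV VB]] := isoB (f a) (fAB _ (imageP f Aa)).
split; first exact: mem_set.
exists (f @^-1` V); first exact: cf.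
apply/seteqP; split=> [x [Vfx Ax]|_ ->]; last first.
  by split=> //; exact: (nbhs_singleton nV).
have : [set f a] (f x) by rewrite -VB; split=> //; exact/fAB/imageP.
by apply: f_inj; rewrite inE.
Qed.

Lemma ptws_cvgP (I : eqType) (X : topologicalType)
    (F : set_system {ptws I -> X}) (f : {ptws I -> X}) :
  Filter F -> F --> f <-> forall i, (fun g : I -> X => g i) @ F --> f i.
Proof.
move=> FF; split=> [Ff i|Ff].
  exact: cvg_comp Ff (@proj_continuous I (fun=> X) i f).
apply/cvg_sup => i A [_ [[B oB <-] Bf BA]]; apply: filterS BA _.
by apply: Ff; exact: open_nbhs_nbhs.
Qed.

Lemma ptws_open_finite_support (I : eqType) (X : topologicalType)
    (U : set {ptws I -> X}) (f : {ptws I -> X}) : open U -> U f ->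
  exists s : seq I, forall g : {ptws I -> X}, {in s, g =1 f} -> U g.
Proof.
move=> oU Uf.
pose agree (s : seq I) := [set g : {ptws I -> X} | {in s, g =1 f}].
have FF : Filter (filter_from setT agree).
  apply: filter_fromT_filter; first by exists [::].
  move=> s t; exists (s ++ t) => g gf.
  by split=> i ist; apply: gf; rewrite mem_cat ist ?orbT.
suff Ff : filter_from setT agree --> f.
  by have [s _] := Ff _ (open_nbhs_nbhs (conj oU Uf)); exists s.
apply/ptws_cvgP => i A /nbhs_singleton Af; exists [:: i] => // g gf /=.
by rewrite gf ?mem_head.
Qed.

Lemma open_coordinate (I : eqType) (X : topologicalType) (V : set X) (i : I) :
  open V -> open [set f : {ptws I -> X} | V (f i)].
Proof.
by apply: open_comp => f _; exact: (@proj_continuous I (fun=> X) i f).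
Qed.

Lemma well_order_trans (T : eqType) (R : rel T) :
  well_order R -> transitive R.
Proof.
move=> woR y x z xy yz; have woT : wo_chain R predT by move=> ? _; exact: woR.
have [|m [[m_xyz m_min] _]] := woR (mem [:: x; y; z]).
  by exists x; exact: mem_head.
have Ranti := wo_chain_antisymmetric woT.
have [mx my mz] : [/\ R m x, R m y & R m z].
  by split; apply: m_min; rewrite !inE eqxx ?orbT.
move: m_xyz; rewrite !inE => /or3P [] /eqP mE; subst m => //.
  by rewrite (Ranti x y) ?xy.
by rewrite -(Ranti y z) ?yz.
Qed.

Lemma well_order_min (T : eqType) (R : rel T) (A : set T) :
  well_order R -> A !=set0 -> exists2 m, A m & forall x, A x -> R m x.
Proof.
move=> woR [x Ax]; have [|m [[/set_mem Am m_min] _]] := woR (mem A).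
  by exists x; exact: mem_set.
by exists m => // y /mem_set; exact: m_min.
Qed.

Definition well_ordered d (O : porderType d) :=
  forall A : set O, A !=set0 -> exists2 m, A m & lbound A m.

Lemma well_ordered_subset (T : eqType) (R : rel T) (A : set T) :
    well_order R -> A !=set0 ->
  exists (d : Order.disp_t) (O : bOrderType d) (f : O -> T),
    [/\ well_ordered O, injective f, range f = A &
        {mono f : x y / x <= y >-> R x y}].
Proof.
move=> woR A0; have woT : wo_chain R predT by move=> ? _; exact: woR.
have [a Aa a_min] := well_order_min woR A0.
pose d := Order.Disp tt tt; pose C := {classic A}.
pose f (x : C) : T := set_val x.
have f_inj : injective f by exact: val_inj.
pose r : rel C := fun x y => R (f x) (f y).
have r_refl : reflexive r by move=> x; exact: (wo_chain_reflexive woT).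
have r_anti : antisymmetric r.
  by move=> x y xy; apply/f_inj/(wo_chain_antisymmetric woT).
have r_trans : transitive r by move=> ? ? ?; exact: (well_order_trans woR).
have r_total : total r by move=> x y; exact: (wo_chainW woT).
pose P : porderType d :=
  HB.pack C (Order.Le_isPOrder.Build d C r_refl r_anti r_trans).
pose O : orderType d := HB.pack C P (Order.POrder_isTotal.Build d P r_total).
pose bot : C := SigSub (mem_set Aa).
have bot_min (x : C) : r bot x by apply: a_min; exact: set_valP.
pose B : bOrderType d := HB.pack C O (Order.hasBottom.Build d O bot_min).
exists d, B, f; split=> //; last first.
  apply/seteqP; split=> [_ [x _ <-]|x Ax]; first exact: set_valP.
  by exists (SigSub (mem_set Ax)).
move=> D [x Dx]; have [|_ [m Dm <-] m_min] := @well_order_min _ _ (f @` D) woR.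
  by exists (f x), x.
by exists m => // y Dy; apply: m_min; exists y.
Qed.

Lemma countable_setU T (A B : set T) :
  countable A -> countable B -> countable (A `|` B).
Proof.
move=> cA cB; rewrite -bigcup2E.
by apply: bigcup_countable => // -[|[|n]] _ //=; exact: countable0.
Qed.

Section TraceSpace.
Context {d : Order.disp_t} {O : bOrderType d}.

Definition trace_space : Type := {Y : set O | countable Y}.

HB.instance Definition _ := Choice.copy trace_space {Y : set O | countable Y}.

Definition of_countable (Y : set O) (cY : countable Y) : trace_space :=
  exist _ Y cY.

Definition trace (a : O) (x : trace_space) : set O := `]-oo, a[ `&` sval x.

Definition condition : Type := trace_space * O.

Definition cylinder (p : condition) : set trace_space :=
  [set y | trace p.2 y = trace p.2 p.1].

Definition extends (p q : condition) := p.2 <= q.2 /\ cylinder p q.1.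

Lemma trace_segment a b x : a <= b -> trace a x = `]-oo, a[ `&` trace b x.
Proof.
move=> ab; rewrite /trace setIA (@setIidl _ `]-oo, a[)// => o /=.
by rewrite !in_itv /= => /lt_le_trans; exact.
Qed.

Lemma trace_le a b x y :
  a <= b -> trace b x = trace b y -> trace a x = trace a y.
Proof. by move=> ab xy; rewrite !(trace_segment _ ab) xy. Qed.

Lemma extends_cylinder p q : extends p q -> cylinder q `<=` cylinder p.
Proof. by move=> [pq qp] x /(trace_le pq); rewrite /cylinder /= qp. Qed.

Lemma extends_refl p : extends p p.
Proof. by split. Qed.

Lemma extends_trans q p r : extends p q -> extends q r -> extends p r.
Proof.
move=> /[dup] pq [le_pq _] [le_qr qr]; split; first exact: le_trans le_qr.
exact: extends_cylinder qr.
Qed.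

Let trace_nbhs (x : trace_space) : set_system trace_space :=
  filter_from [set: O] (fun a => cylinder (x, a)).

Let trace_nbhs_filter x : ProperFilter (trace_nbhs x).
Proof.
apply: filter_from_proper; last by move=> a _; exists x.
apply: filter_fromT_filter; first by exists \bot.
move=> a b; exists (Order.max a b) => y yx.
by split; apply: trace_le yx; rewrite le_max lexx ?orbT.
Qed.

Let trace_nbhs_singleton x U : trace_nbhs x U -> U x.
Proof. by move=> [a _]; apply. Qed.

Let trace_nbhs_nbhs x U : trace_nbhs x U -> trace_nbhs x (trace_nbhs^~ U).
Proof.
move=> [a _ xaU]; exists a => // y xy; exists a => // z yz; apply: xaU.
by rewrite /cylinder /= yz.
Qed.

HB.instance Definition _ := hasNbhs.Build trace_space trace_nbhs.
HB.instance Definition _ := Nbhs_isNbhsTopological.Build trace_space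
  trace_nbhs_filter trace_nbhs_singleton trace_nbhs_nbhs.

Lemma trace_preimage_clopen a (Q : set (set O)) :
  clopen (trace a @^-1` Q : set trace_space).
Proof.
suff openQ (R : set (set O)) : open (trace a @^-1` R : set trace_space).
  by split=> //; rewrite -openC preimage_setC.
by rewrite openE => x Rx; exists a => // y /= ->.
Qed.

Lemma cylinder_open p : open (cylinder p).
Proof. by have [] := trace_preimage_clopen p.2 [set trace p.2 p.1]. Qed.

Lemma nowhere_dense_cylinderP (A : set trace_space) : nowhere_dense A <->
  forall p, exists2 q, extends p q & cylinder q `&` A = set0.
Proof.
split=> [/nowhere_denseP ndA p|avoidA].
  have [|V [oV [y Vy] Vp VA]] := ndA _ (@cylinder_open p); first by exists p.1.
  have [b _ yV] : nbhs y V by exact: open_nbhs_nbhs.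
  exists (y, Order.max p.2 b); first by split; [rewrite le_max lexx|exact: Vp].
  apply: subsetI_eq0 VA => // z zy; apply: yV.
  by apply: trace_le zy; rewrite le_max lexx orbT.
apply/nowhere_denseP => U oU [x Ux].
have [a _ xU] : nbhs x U by exact: open_nbhs_nbhs.
have [q xq qA] := avoidA (x, a); exists (cylinder q); split=> //.
- exact: cylinder_open.
- by exists q.1.
- by apply: subset_trans xU; exact: extends_cylinder.
Qed.

Lemma increasing_conditions_limit (p : nat -> condition) :
  (forall n, extends (p n) (p n.+1)) -> exists y, forall n, cylinder (p n) y.
Proof.
move=> p_step.
have p_mono : {homo p : m n / (m <= n)%N >-> extends m n}.
  apply: homo_leq p_step => [?|? ? ?]; first exact: extends_refl.
  exact: extends_trans.
pose Y := \bigcup_n trace (p n).2 (p n).1.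
have cY : countable Y.
  apply: bigcup_countable => // n _.
  exact: sub_countable (subset_card_le (@subIsetr _ _ _)) (svalP (p n).1).
exists (of_countable cY) => n.
apply/seteqP; split=> o [on]; last first.
  by move=> no; split=> //; exists n.
move=> [m _ [om mo]]; split=> //.
have [/p_mono [_ mn]|/ltnW/p_mono [_ nm]] := leqP m n.
  have : trace (p m).2 (p m).1 o by [].
  by rewrite -[trace _ _]mn => -[].
have : trace (p n).2 (p m).1 o by [].
by rewrite [trace _ _]nm => -[].
Qed.

End TraceSpace.
Arguments trace_space {d} O.
Arguments condition {d} O.

Lemma cantor_powerset (L : Type) : ~ ([set: set L] #<= [set: L]).
Proof.
move=> /pcard_surjP [g gsurj].
have [l _ gl] := gsurj [set l | ~ g l l] I.
have : g l l <-> ~ g l l by rewrite {1}gl.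
tauto.
Qed.

Section Successor.
Context {L : pointedType}.
Hypothesis card_nat_le : [set: nat] #<= [set: L].
Hypothesis card_sequences_le : [set: nat -> L] #<= [set: L].

Definition small T (A : set T) : bool := A #<= [set: L].

Lemma small_subset T (A B : set T) : A `<=` B -> small B -> small A.
Proof. by move=> /subset_card_le; exact: card_le_trans. Qed.

Lemma small_image T U (f : T -> U) (A : set T) : small A -> small (f @` A).
Proof. exact/card_le_trans/card_image_le. Qed.

Lemma countable_small T (A : set T) : countable A -> small A.
Proof. by move=> cA; exact: card_le_trans card_nat_le. Qed.

Lemma small_pairs : small [set: L * L].
Proof.
apply: card_le_trans card_sequences_le; apply/pcard_injP.
exists (fun xy n => if n is 0%N then xy.1 else xy.2) => -[x y] [x' y'] _ _ e.
by congr (_, _); [exact: (congr1 (@^~ 0%N) e)|exact: (congr1 (@^~ 1%N) e)].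
Qed.

Lemma small_bigcup I T (D : set I) (F : I -> set T) :
  small D -> (forall i, D i -> small (F i)) -> small (\bigcup_(i in D) F i).
Proof.
move=> /pcard_injP [d d_inj] smallF; apply: card_le_trans small_pairs.
elim/Ppointed: I => I in D F d d_inj smallF *.
  by rewrite emptyE bigcup_set0 card_ge0.
have /choice [f f_inj] : forall i, exists f : T -> L,
    D i -> {in F i &, injective f}.
  move=> i; have [Di|nDi] := pselect (D i); last by exists (fun=> point).
  by have /pcard_injP [f] := smallF i Di; exists f.
pose idx x := xget point [set i | D i /\ F i x].
have idxP x : (\bigcup_(i in D) F i) x -> D (idx x) /\ F (idx x) x.
  move=> [i Di Fix].
  by apply: (@xgetPex _ point [set i | D i /\ F i x]); exists i.
apply/pcard_injP; exists (fun x => (d (idx x), f (idx x) x)) => x y.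
rewrite !inE => /idxP [Dx Fx] /idxP [Dy Fy] [dE fE].
have idxE : idx x = idx y by apply: d_inj; rewrite ?inE.
by rewrite -idxE in fE Fy; apply: (f_inj _ Dx); rewrite ?inE.
Qed.

Lemma small_setU T (A B : set T) : small A -> small B -> small (A `|` B).
Proof.
move=> smallA smallB; rewrite -bigcup2E.
by apply: small_bigcup => // -[|[|n]] _ //=; exact: card_ge0.
Qed.

Lemma small_countable_subsets T (B : set T) :
  small B -> small [set A | A `<=` B /\ countable A].
Proof.
elim/Ppointed: T => T in B *.
  move=> _; apply: small_subset (countable_small (countable1 set0)) => A _.
  by rewrite emptyE.
move=> /pcard_surjP [g g_surj].
apply: (@small_subset _ _
    ([set set0] `|` [set range (g \o u) | u in [set: nat -> L]])); last first.
  by apply: small_setU; [exact/countable_small/countable1|exact: small_image].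
move=> A [AB /pfcard_geP [->|[u]]]; [by left|right].
have /choice [v vP] : forall n, exists l, g l = u n.
  by move=> n; have [l] := g_surj _ (AB _ (@funS _ _ _ _ u n I)); exists l.
by exists v => //; rewrite (_ : g \o v = u) ?image_eq//; apply/funext => n /=.
Qed.

Record successor_order d (O : orderType d) : Prop := {
  successor_well_ordered : well_ordered O;
  small_segment : forall k : O, small `]-oo, k[;
  successor_not_small : ~ small [set: O] }.

Lemma successor_order_exists :
  exists (d : Order.disp_t) (O : bOrderType d), successor_order O.
Proof.
pose T := {classic set L}; have [R woR] := well_ordering_principle T.
pose segment x := [set y | ~~ R x y]; pose A := [set x | small (segment x)].
have A_not_small : ~ small A.
  move=> smallA; have AT : A = setT.
    apply/seteqP; split=> // x _; apply: contrapT => nAx.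
    have [|k nAk k_min] := @well_order_min _ _ (~` A) woR; first by exists x.
    apply: nAk; apply: small_subset smallA => y /negP nky.
    by apply: contrapT => /k_min.
  by rewrite AT in smallA; exact: cantor_powerset smallA.
have A0 : A !=set0.
  by apply/set0P/eqP => A0; apply: A_not_small; rewrite A0; exact: card_ge0.
have [d [O [f [woO f_inj fA f_mono]]]] := well_ordered_subset woR A0.
exists d, O; split=> // [k|].
  have : A (f k) by rewrite -fA; exists k.
  apply: card_le_trans; rewrite -(card_le_eql (inj_card_eq (in2W f_inj))).
  by apply: subset_card_le => _ [x xk <-]; rewrite /segment /= f_mono -ltNge.
by move=> smallO; apply: A_not_small; rewrite -fA; exact: small_image.
Qed.

Context {d : Order.disp_t} {O : bOrderType d} (succO : successor_order O).

Lemma small_bounded (A : set O) :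
  small A -> exists k, forall x, A x -> x < k.
Proof.
move=> smallA; apply: contrapT => unbounded.
apply: (successor_not_small succO).
apply: (@small_subset _ _ ((\bigcup_(x in A) `]-oo, x[) `|` A)).
  move=> k _; apply: contrapT => nk; apply: unbounded; exists k => x Ax.
  by case: ltgtP => // [kx|xk]; case: nk; [left; exists x|right; rewrite -xk].
apply: small_setU => //; apply: small_bigcup => // x _.
exact: small_segment.
Qed.

Lemma sequence_bounded (u : nat -> O) : exists k, forall n, u n < k.
Proof.
have [|k kP] := @small_bounded (range u); first exact: small_image.
by exists k => n; apply: kP; exists n.
Qed.

Lemma exists_gt (k : O) : exists k', k < k'.
Proof.
by have [k' kP] := sequence_bounded (fun=> k); exists k'; exact: kP 0%N.
Qed.

Lemma iterates_cofinal (h : O -> O) (x : O) :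
  exists2 k, x < k & forall y, y < k -> exists2 z, y <= z & h z < k.
Proof.
have [k x_lt k_min] :=
  successor_well_ordered succO (sequence_bounded (fun n => iter n h x)).
exists k; first exact: (x_lt 0%N).
move=> y yk; have [n yn] : exists n, y <= iter n h x.
  apply: contrapT => ny; suff /k_min : forall n, iter n h x < y.
    by rewrite leNgt yk.
  by move=> n; rewrite ltNge; apply/negP => yn; apply: ny; exists n.
by exists (iter n h x); last exact: (x_lt n.+1).
Qed.

Implicit Types (A : set (trace_space O)) (p q : condition O).

Lemma trace_ext (x y : trace_space O) :
  (forall a, trace a x = trace a y) -> x = y.
Proof.
have sub (z t : trace_space O) :
    (forall a, trace a z = trace a t) -> sval z `<=` sval t.
  move=> zt o zo; have [k ok] := exists_gt o.
  have : trace k z o by split=> //; rewrite /= in_itv.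
  by rewrite zt => -[].
by move=> xy; apply/val_inj/seteqP; split; exact: sub.
Qed.

Lemma trace_space_accessible : accessible_space (trace_space O).
Proof.
move=> x y /eqP xy; have [a xya] : exists a, trace a y <> trace a x.
  apply: contrapT => /forallNP yx; apply: xy; apply: trace_ext => a.
  exact/esym/(contrapT (yx a)).
by exists (cylinder (x, a)); split; [exact: cylinder_open| |]; rewrite inE.
Qed.

Lemma trace_space_perfect : perfect_set [set: trace_space O].
Proof.
apply/perfectTP => x; rewrite openE => /(_ x erefl) [a _ xa].
have cU1 b : countable (b |` sval x).
  by apply: countable_setU; [exact: countable1|exact: (svalP x)].
have [o x_lt] := small_bounded (countable_small (cU1 a)).
have xo : ~ sval x o by move=> xo; have := x_lt o (or_intror xo); rewrite ltxx.
have yx : of_countable (cU1 o) = x.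
  apply: xa; apply/seteqP; split=> z [za] /=; last by split=> //; right.
  move=> [zo|]; last by split.
  have ao : a < o by apply: x_lt; left.
  by move: za; rewrite zo /= in_itv /= lt_gtF.
by apply: xo; rewrite -yx; left.
Qed.

Lemma trace_space_sigma_closed : nowhere_dense_sigma_closed (trace_space O).
Proof.
move=> A ndA; apply/nowhere_dense_cylinderP => p0.
have /choice [avoid avoidP] : forall np : nat * condition O,
    exists q, extends np.2 q /\ cylinder q `&` A np.1 = set0.
  move=> [n p]; have [q pq qA] := (nowhere_dense_cylinderP _).1 (ndA n) p.
  by exists q.
pose p := fix p n := if n is m.+1 then avoid (m, p m) else p0.
have p_step n : extends (p n) (p n.+1) by have [] := avoidP (n, p n).
have [y yP] := increasing_conditions_limit p_step.
have [b bP] := sequence_bounded (fun n => (p n).2).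
have py n : extends (p n) (y, b) by split; [exact/ltW/bP|exact: yP].
exists (y, b); first exact: (py 0%N).
rewrite setI_bigcupr; apply: bigcup0 => n _.
have [_] := avoidP (n, p n); apply: subsetI_eq0 => //.
exact: extends_cylinder (py n.+1).
Qed.

Lemma small_traces a : small (range (@trace d O a)).
Proof.
apply: small_subset (small_countable_subsets (small_segment succO a)).
move=> _ [x _ <-]; split; first by move=> o [].
exact: sub_countable (subset_card_le (@subIsetr _ _ _)) (svalP x).
Qed.

(* Avoiding [A] from level [a] depends only on traces below [a], of which there
   are few: a single level works for all of them. *)
Lemma uniform_avoidance A a : nowhere_dense A -> exists b, forall x,
  exists2 q, extends (x, a) q & q.2 <= b /\ cylinder q `&` A = set0.
Proof.
move=> /nowhere_dense_cylinderP ndA.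
have /choice [q qP] : forall t, exists q, forall x, trace a x = t ->
    extends (x, a) q /\ cylinder q `&` A = set0.
  move=> t; have [[x xt]|nx] := pselect (exists x, trace a x = t).
    have [q [aq xq] qA] := ndA (x, a); exists q => y yt.
    by split=> //; split=> //; rewrite /cylinder /= yt -xt.
  by exists (of_countable (countable0 O), a) => x xt; case: nx; exists x.
have [b bP] := small_bounded (small_image (fun t => (q t).2) (small_traces a)).
exists b => x; have [xq qA] := qP _ x erefl; exists (q (trace a x)) => //.
by split=> //; apply/ltW/bP; exists (trace a x) => //; exists x.
Qed.

Definition avoidance_level A k := forall p, p.2 < k ->
  exists2 q, extends p q & q.2 < k /\ cylinder q `&` A = set0.

Lemma avoidance_level_exists A :
  nowhere_dense A -> exists2 k, \bot < k & avoidance_level A k.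
Proof.
move=> ndA; have /choice [h hP] := fun a => uniform_avoidance a ndA.
have [k k_gt k_cofinal] := iterates_cofinal h \bot.
exists k => // p /k_cofinal [b pb hbk].
have [q bq [qh qA]] := hP b p.1; exists q; last first.
  by split=> //; exact: le_lt_trans hbk.
by apply: extends_trans bq; split.
Qed.

(* Levels are treated in increasing order, so that a condition avoiding one set
   still lies below the levels of the remaining ones. *)
Lemma avoid_at_levels (k : set (trace_space O) -> O)
    (s : seq (set (trace_space O))) p :
    {in s, forall A, avoidance_level A (k A) /\ p.2 < k A} ->
    pairwise (fun A B => k A <= k B) s ->
  exists2 y, cylinder p y & {in s, forall A, cylinder (y, k A) `&` A = set0}.
Proof.
elim: s p => [|A s IHs] p s_levels /=; first by exists p.1.
move=> /andP [/allP A_min s_sorted].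
have [A_level pA] := s_levels A (mem_head _ _).
have [q pq [qA q_avoids]] := A_level p pA.
have [B Bs|y qy y_avoids] := IHs q _ s_sorted.
  have [B_level _] := s_levels B (mem_behead (s := A :: s) Bs).
  by split=> //; exact: lt_le_trans (A_min B Bs).
exists y => [|B]; first exact: extends_cylinder pq _ qy.
rewrite inE => /predU1P [->|]; last exact: y_avoids.
apply: subsetI_eq0 q_avoids => //; apply: extends_cylinder.
by split=> //; exact: ltW.
Qed.

Lemma trace_space_remote_filter : has_remote_filter (trace_space O).
Proof.
have /choice [k kP] : forall A, exists k : O,
    nowhere_dense A -> \bot < k /\ avoidance_level A k.
  move=> A; have [ndA|] := pselect (nowhere_dense A); last by exists \bot.
  by have [k k_gt kA] := avoidance_level_exists ndA; exists k.
pose W A := [set y | cylinder (y, k A) `&` A = set0].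
pose ND := [set A : set (trace_space O) | nowhere_dense A].
have W_finI : finI ND W.
  move=> D DND; pose leT A B := k A <= k B.
  have leT_total : total leT by move=> A B; exact: le_total.
  have leT_trans : transitive leT by move=> A B C; exact: le_trans.
  have [A||y _ yD] := @avoid_at_levels k (sort leT (finmap.enum_fset D))
    (of_countable (countable0 O), \bot).
  - by rewrite mem_sort => /DND /set_mem /kP [].
  - by rewrite -sorted_pairwise// sort_sorted.
  - by exists y => A /= AD; apply: yD; rewrite mem_sort.
exists (filter_from (finI_from ND W) id); first exact: finI_filter.
move=> A ndA; exists (W A); split.
- exact: (trace_preimage_clopen (k A)
    [set t | (trace (k A) @^-1` [set t]) `&` A = set0]).
- by exists (W A) => //; exact: finI_from1.
- by apply/disjoints_subset => y /disjoints_subset; exact.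
Qed.

End Successor.

Lemma nat_le_continuum : [set: nat] #<= [set: nat -> bool].
Proof.
apply/pcard_injP; exists (fun m n : nat => n == m) => m n _ _ /(congr1 (@^~ m)).
by rewrite eqxx => /esym/eqP.
Qed.

Lemma continuum_sequences_le_continuum :
  [set: nat -> nat -> bool] #<= [set: nat -> bool].
Proof.
apply/pcard_injP.
exists (fun f n => oapp (fun ij : nat * nat => f ij.1 ij.2) false (unpickle n)).
move=> f g _ _ fg; apply/funext => i; apply/funext => j.
by have := congr1 (@^~ (pickle (i, j))) fg; rewrite pickleK.
Qed.

Lemma remote_space_exists : exists P : topologicalType,
  [/\ accessible_space P, perfect_set [set: P],
      nowhere_dense_sigma_closed P & has_remote_filter P].
Proof.
have [d [O succO]] := @successor_order_exists (nat -> bool).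
have [natL seqL] := (nat_le_continuum, continuum_sequences_le_continuum).
exists (trace_space O); split.
- exact: (trace_space_accessible natL seqL succO).
- exact: (trace_space_perfect natL seqL succO).
- exact: (trace_space_sigma_closed natL seqL succO).
- exact: (trace_space_remote_filter natL seqL succO).
Qed.

Lemma separating_points (T : Type) (x0 : T) (r : seq (set T)) :
  exists c : nat * nat -> T, {in r &, injective (preimage c)}.
Proof.
have /choice [d dP] : forall AB : set T * set T, exists x : T,
    (AB.1 x <-> AB.2 x) -> AB.1 = AB.2.
  move=> [A B] /=; have [<-|AB] := pselect (A = B); first by exists x0.
  have [x ABx] : exists x, ~ (A x <-> B x).
    apply: contrapT => /forallNP ABx; apply/AB/seteqP.
    by split=> x; have /contrapT [] := ABx x.
  by exists x.
exists (fun ij => d (nth set0 r ij.1, nth set0 r ij.2)) => A B Ar Br.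
move=> /(congr1 (@^~ (index A r, index B r))).
by rewrite /preimage /= !nth_index// => AB; apply: (dP (A, B)); rewrite /= AB.
Qed.

(* A [Node] carries the points on which a coordinate is tested and the value
   attached to each outcome; the leaves make the type at least as large as [K]
   and inhabited. *)
Inductive slot (K P X : Type) : Type :=
  | Leaf of option K
  | Node of (nat * nat -> slot K P X * P) & (set (nat * nat) -> X).

Section SlotPower.
Context {K : Type} {P X : topologicalType}.
Context {F : set_system P} {FF : ProperFilter F}.
Context (W : set P -> set P) (a : X).
Hypothesis W_clopen : forall A, clopen (W A).
Hypothesis W_filter : forall A, F (W A).
Hypothesis W_remote : forall A, nowhere_dense A -> W A `&` A = set0.

Local Notation S := (slot K P X).
Local Notation coord := (set (S * P)).

Definition slot_value (s : S) (e : coord) : X :=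
  if s is Node c v then v (c @^-1` e) else a.

Definition slot_point (p : S * P) : {ptws coord -> X} := fun e =>
  if p.2 \in W (xsection e p.1) then slot_value p.1 e else a.

Lemma slot_point_dense : dense (range slot_point).
Proof.
move=> U [f Uf] oU; have [r rU] := ptws_open_finite_support oU Uf.
have [x0 _] := @filter_ex _ F _ _ filterT.
have [c c_inj] := separating_points (Leaf P X None : S, x0) r.
pose v := f \o 'pinv_(fun=> set0) [set` r] (preimage c).
have vE : {in r, forall e, v (c @^-1` e) = f e}.
  move=> e er; rewrite /v /= pinvKV ?inE// => A B; rewrite !inE => Ar Br.
  exact: c_inj.
pose s : S := Node c v.
have /filter_ex [x xW] : F [set x | {in r, forall e, W (xsection e s) x}].
  elim: (r) => [|e r' IHr]; first exact: filterE.
  apply: filterS (filterI (W_filter (xsection e s)) IHr) => x [Wex Wrx] A.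
  by rewrite inE => /predU1P [->|/Wrx].
exists (slot_point (s, x)); split; last by exists (s, x).
apply: rU => e er; rewrite /slot_point /= mem_set; last exact: xW.
exact: vE.
Qed.

Lemma slot_point_continuous s : continuous (fun x => slot_point (s, x)).
Proof.
move=> x; apply/ptws_cvgP => e U /nbhs_singleton.
rewrite /slot_point /=; have [oW cW] := W_clopen (xsection e s).
have [Wx|nWx] := boolP (x \in W (xsection e s)) => Ux.
  have : nbhs x (W (xsection e s)).
    by apply: open_nbhs_nbhs; split=> //; exact: set_mem.
  by apply: filterS => y /mem_set /= ->.
have : nbhs x (~` W (xsection e s)).
  apply: open_nbhs_nbhs; split; first exact: closed_openC.
  by move: nWx; rewrite notin_setE.
by apply: filterS => y nWy; rewrite /= memNset.
Qed.

Lemma slot_power_not_D_separable (V : set X) (b : X) :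
  (forall A : set P, discrete_subset A -> nowhere_dense A) ->
  nowhere_dense_sigma_closed P ->
  open V -> V b -> ~ V a -> ~ D_separable {ptws coord -> X}.
Proof.
move=> discrete_nd sigma_nd oV Vb nVa.
move=> /(_ (fun=> range slot_point) (fun=> slot_point_dense)) [D [Drange dD]].
have /choice [q qP] : forall f, exists p,
    range slot_point f -> slot_point p = f.
  move=> f; have [[p _ <-]|nf] := pselect (range slot_point f).
    by exists p.
  have [x0 _] := @filter_ex _ F _ _ filterT.
  by exists (Leaf P X None : S, x0).
have qD n : {in D n, cancel q slot_point}.
  by move=> f /set_mem /Drange /qP.
pose e : coord := \bigcup_n q @` D n.
have nd_slice s : nowhere_dense (xsection e s).
  rewrite xsection_bigcup; apply: sigma_nd => n; apply: discrete_nd.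
  apply: (discrete_subset_preimage (@slot_point_continuous s) _ _ (dD n)).
    move=> x y; rewrite !inE => /xsectionP [f Df fx] /xsectionP [g Dg gy] xy.
    suff : (s, x) = (s, y) by case.
    by rewrite -fx -gy -(qD n f) ?inE// -(qD n g) ?inE// fx gy xy.
  by move=> _ [x /xsectionP [f Df <-] <-]; rewrite (qD n) ?inE.
move=> /(_ [set f : {ptws coord -> X} | V (f e)]) [||f [Vf [n _ Df]]].
- by exists (fun=> b).
- exact: open_coordinate.
move: Vf; rewrite /= -(qD n f) ?inE// /slot_point; case: ifPn => // /set_mem Wx.
suff : (W (xsection e (q f).1) `&` xsection e (q f).1) (q f).2.
  by rewrite W_remote.
split=> //; apply/xsectionP; rewrite -surjective_pairing.
by exists n => //; exists f.
Qed.

End SlotPower.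

Lemma card_le_slot_coordinates (K : Type) (P X : Type) (x0 : P) :
  [set: K] #<= [set: set (slot K P X * P)].
Proof.
apply/pcard_injP; exists (fun k => [set p | p.1 = Leaf P X (Some k)]).
move=> k k' _ _ /seteqP [/(_ (Leaf P X (Some k), x0)) + _].
by move=> /(_ erefl) [].
Qed.

Theorem theorem36 (X : topologicalType) (hX : tychonoff_space X)
    (hX2 : exists x y : X, x <> y) (K : Type) :
  exists K' : Type,
    [set: K] #<= [set: K'] /\ ~ D_separable {ptws K' -> X}.
Proof.
have [b [a /eqP ab]] := hX2; have [T1 _] := hX.
have [V [oV /set_mem Vb /set_mem nVa]] := T1 b a ab.
have [P [P_T1 P_perfect P_sigma remote]] := remote_space_exists.
have [F FF [W [W_clopen W_filter W_remote]]] := remote_filter_selection remote.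
exists (set (slot K P X * P)); split.
  have [x0 _] := filter_ex (@filterT _ F _).
  exact: card_le_slot_coordinates x0.
apply: (slot_power_not_D_separable W_clopen W_filter W_remote) oV Vb nVa => //.
by move=> A; exact: discrete_nowhere_dense.
Qed.
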